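(* Let $\mathbb{K}$ be a field of characteristic zero, let $\mathcal{W}_2$ be the terminal algebra of all $2$-dimensional commutative algebras over $\mathbb{K}$, and let $d:\mathcal{W}_2\to\mathcal{W}_2$ be a linear map. Then $d$ is a $\frac12$-derivation of $\mathcal{W}_2$ if and only if there exists a scalar $\lambda\in\mathbb{K}$ such that $d(x)=\lambda x$ for all $x\in\mathcal{W}_2$.
   Context: Algebras are vector spaces over $\mathbb{K}$ with a bilinear multiplication; they need not be associative, commutative or unital. The algebra $\mathcal{W}_2$ (Kantor's algebra of all bilinear commutative operations on a $2$-dimensional space) is the $6$-dimensional algebra over $\mathbb{K}$ with basis $\xi_1,\dots,\xi_6$ and the following multiplication (left factor first; all products of basis elements not listed are $0$): $\xi_1\xi_1=-\xi_1$, $\xi_1\xi_3=\xi_3$, $\xi_1\xi_4=-2\xi_4$, $\xi_1\xi_5=-\xi_5$; $\xi_2\xi_1=-\xi_2$, $\xi_2\xi_2=-2\xi_3$, $\xi_2\xi_4=\xi_1-\xi_5$, $\xi_2\xi_5=\xi_2-2\xi_6$, $\xi_2\xi_6=\xi_3$; $\xi_4\xi_1=\xi_4$, $\xi_4\xi_2=\xi_5-2\xi_1$, $\xi_4\xi_3=-\xi_2+\xi_6$, $\xi_4\xi_5=-2\xi_4$, $\xi_4\xi_6=-\xi_5$; $\xi_5\xi_2=-\xi_2$, $\xi_5\xi_3=-2\xi_3$, $\xi_5\xi_4=\xi_4$, $\xi_5\xi_6=-\xi_6$. A linear map $d:\mathcal{A}\to\mathcal{A}$ on an algebra $\mathcal{A}$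 is a $\frac12$-derivation if $d(xy)=\frac12\big(d(x)y+x\,d(y)\big)$ for all $x,y\in\mathcal{A}$. *)

(* Defs.v *)
From HB Require Import structures.
From mathcomp Require Import all_boot all_order all_algebra.

Set Implicit Arguments.
Unset Strict Implicit.
Unset Printing Implicit Defensive.

Import GRing.Theory.
Local Open Scope ring_scope.

(* An algebra is a K-vector space A with a bilinear product mul; no further
   identity (associativity, commutativity, unit) is required. *)
Definition half_derivation (K : fieldType) (A : lmodType K)
    (mul : {bilinear A -> A -> A}) (d : {linear A -> A}) : Prop :=
  forall x y : A, d (mul x y) = 2%:R^-1 *: (mul (d x) y + mul x (d y)).

(* Kantor's algebra of the bilinear commutative operations on a 2-dimensional
   space, in coordinates with respect to its basis xi 1, ..., xi 6. *)
Definition W2 (K : fieldType) : lmodType K := 'rV[K]_6.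

(* Indices run from 1 to 6, whereas the coordinates of 'rV_6 start at 0. *)
Definition xi (K : fieldType) (k : nat) : 'rV[K]_6 :=
  delta_mx 0 (inord k.-1).

(* The product of xi i (on the left) and xi j, with i and j in 1..6. *)
Definition W2_table (K : fieldType) (i j : nat) : 'rV[K]_6 :=
  match i, j with
  | 1%N, 1%N => - xi K 1
  | 1%N, 3%N => xi K 3
  | 1%N, 4%N => - (2%:R *: xi K 4)
  | 1%N, 5%N => - xi K 5
  | 2%N, 1%N => - xi K 2
  | 2%N, 2%N => - (2%:R *: xi K 3)
  | 2%N, 4%N => xi K 1 - xi K 5
  | 2%N, 5%N => xi K 2 - 2%:R *: xi K 6
  | 2%N, 6%N => xi K 3
  | 4%N, 1%N => xi K 4
  | 4%N, 2%N => xi K 5 - 2%:R *: xi K 1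
  | 4%N, 3%N => - xi K 2 + xi K 6
  | 4%N, 5%N => - (2%:R *: xi K 4)
  | 4%N, 6%N => - xi K 5
  | 5%N, 2%N => - xi K 2
  | 5%N, 3%N => - (2%:R *: xi K 3)
  | 5%N, 4%N => xi K 4
  | 5%N, 6%N => - xi K 6
  | _, _ => 0
  end.

Definition W2_mul (K : fieldType) (x y : W2 K) : W2 K :=
  \sum_(i < 6) \sum_(j < 6) (x 0 i * y 0 j) *: W2_table K i.+1 j.+1.

Lemma W2_mul_is_bilinear (K : fieldType) :
  bilinear_for *:%R *:%R (@W2_mul K).
Proof.
split=> [u a x y | u a x y] /=; rewrite /W2_mul scaler_sumr -big_split;
  apply: eq_bigr => i _; rewrite scaler_sumr -big_split;
  apply: eq_bigr => j _; rewrite /= !mxE scalerA -scalerDl.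
- by rewrite mulrDl mulrA.
- by rewrite mulrDr mulrCA.
Qed.

HB.instance Definition _ (K : fieldType) :=
  bilinear_isBilinear.Build K (W2 K) (W2 K) (W2 K) *:%R *:%R (@W2_mul K)
    (@W2_mul_is_bilinear K).

Lemma W2_mul_xi (K : fieldType) (i j : nat) : (0 < i <= 6)%N -> (0 < j <= 6)%N ->
  W2_mul (xi K i) (xi K j) = W2_table K i j.
Proof.
case: i => // i; case: j => // j /= lti ltj; rewrite /W2_mul.
rewrite (bigD1 (Ordinal lti)) //= [X in _ + X]big1 => [|k nek]; last first.
  rewrite big1 // => l _; rewrite !mxE /= [k == _](_ : _ = false) ?mul0r ?scale0r //.
  by apply: contraNF nek => /eqP->; apply/eqP/val_inj; rewrite /= inordK.
rewrite addr0 (bigD1 (Ordinal ltj)) //= [X in _ + X]big1 => [|k nek]; last first.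
  rewrite !mxE /= [k == _](_ : _ = false) ?mulr0 ?scale0r //.
  by apply: contraNF nek => /eqP->; apply/eqP/val_inj; rewrite /= inordK.
have E n (ltn : (n < 6)%N) : Ordinal ltn == inord n by rewrite -val_eqE /= inordK.
by rewrite !mxE /= !E mul1r scale1r addr0.
Qed.

(* Main.v *)
Require Import Defs.
From mathcomp Require Import all_boot all_order all_algebra.
Import GRing.Theory.
Local Open Scope ring_scope.

Set Implicit Arguments.
Unset Strict Implicit.
Unset Printing Implicit Defensive.

(** Write [e] for [xi 1]; then [e * e = - e], and both multiplications by [e]
    are diagonal in the basis [xi 1, ..., xi 6], with integer eigenvalues: the
    basis vectors have a left and a right weight.

    Applying a half-derivation [d] to [e * e = - e] shows that [d e] is killed
    by [L_e + R_e + 2], which is diagonal with entries [0, 1, 3, 1, 1, 2]; hence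
    [d e = lambda e] ([half_derivation_xi1]).  Since scalar maps are
    half-derivations, [D = d - lambda] is again one, and now [D e = 0].  The rule
    for [D (e * v)] then collapses to [2 D (e * v) = e * D v], so that [D] doubles
    left weights, and right weights for the same reason ([weights_double]).  The
    pairs of weights of [xi 1, ..., xi 6] are
    [(-1, -1), (0, -1), (1, 0), (-2, 1), (-1, 0), (0, 0)].
    Doubling the pair of [xi 2], [xi 3], [xi 4] or [xi 5] gives a pair
    that is not in this list, and stays so in [K] because distinct integers
    remain distinct in characteristic zero; so [D] kills these vectors,
    and [D] maps [xi 6], of weights [(0, 0)], to a multiple [c xi 6] of itself.
    Finally [xi 2 * xi 6 = xi 3] gives [0 = 2 D (xi 3) = c xi 3], so [c = 0] and [D = 0]. *)

Lemma intr_eq0_pchar0 (K : fieldType) (char0 : [pchar K] =i pred0) (m : int) :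
  (m%:~R == 0 :> K) = (m == 0).
Proof.
have nat_eq0 := (pcharf0P K).1 char0.
by case: m => n; rewrite ?NegzE ?mulrNz ?oppr_eq0 -pmulrn nat_eq0.
Qed.

Section HalfDerivations.

Variables (K : fieldType) (A : lmodType K) (mul : {bilinear A -> A -> A}).
Hypothesis char0 : [pchar K] =i pred0.

Let two_neq0 : 2%:R != 0 :> K.
Proof. by rewrite ((pcharf0P K).1 char0). Qed.

Lemma half_derivationP (d : {linear A -> A}) :
  half_derivation mul d <->
  forall x y, 2%:R *: d (mul x y) = mul (d x) y + mul x (d y).
Proof.
split=> hd x y; first by rewrite hd scalerA divff // scale1r.
by rewrite -hd scalerA mulVf // scale1r.
Qed.

Lemma half_derivation_scalar (d : {linear A -> A}) (lambda : K) :
  (forall x, d x = lambda *: x) -> half_derivation mul d.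
Proof.
move=> dE; apply/half_derivationP => x y.
by rewrite !dE linearZl_LR linearZr_LR /= scaler_nat mulr2n.
Qed.

Lemma half_derivation_subZ (d : {linear A -> A}) (lambda : K) :
  half_derivation mul d ->
  half_derivation mul (d \- lambda \*: idfun)%R.
Proof.
move=> /half_derivationP hd; apply/half_derivationP => x y /=.
rewrite scalerBr hd linearBl linearBr linearZl_LR linearZr_LR /=.
by rewrite scaler_nat mulr2n opprD addrACA.
Qed.

End HalfDerivations.

Section Weights.

Variable K : fieldType.
Hypothesis char0 : [pchar K] =i pred0.

Definition left_weight (i : 'I_6) : int := [:: -1; 0; 1; -2; -1; 0]`_i.
Definition right_weight (i : 'I_6) : int := [:: -1; -1; 0; 1; 0; 0]`_i.

Lemma xi_ord (i : 'I_6) : xi K i.+1 = delta_mx 0 i.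
Proof. by rewrite /xi /= inord_val. Qed.

Lemma xi_expansion (x : W2 K) : x = \sum_(i < 6) x 0 i *: xi K i.+1.
Proof.
by rewrite [LHS]row_sum_delta; apply: eq_bigr => i _; rewrite xi_ord.
Qed.

Lemma xi1_mul_xi (i : 'I_6) :
  W2_mul (xi K 1) (xi K i.+1) = (left_weight i)%:~R *: xi K i.+1.
Proof.
rewrite W2_mul_xi ?ltn_ord //.
by case: i => [[|[|[|[|[|[|//]]]]]] ?] /=;
  rewrite ?scaleNr ?scale0r ?scale1r.
Qed.

Lemma xi_mul_xi1 (i : 'I_6) :
  W2_mul (xi K i.+1) (xi K 1) = (right_weight i)%:~R *: xi K i.+1.
Proof.
rewrite W2_mul_xi ?ltn_ord //.
by case: i => [[|[|[|[|[|[|//]]]]]] ?] /=;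
  rewrite ?scaleNr ?scale0r ?scale1r.
Qed.

Lemma sum_xi_coord (c : 'I_6 -> K) (i : 'I_6) :
  (\sum_(j < 6) c j *: xi K j.+1) 0 i = c i.
Proof.
rewrite summxE (bigD1 i) //= big1 => [|j neji].
  by rewrite xi_ord !mxE !eqxx mulr1 addr0.
by rewrite xi_ord !mxE eqxx eq_sym (negbTE neji) mulr0.
Qed.

Lemma xi1_mul_coord (x : W2 K) (i : 'I_6) :
  W2_mul (xi K 1) x 0 i = (left_weight i)%:~R * x 0 i.
Proof.
rewrite {1}(xi_expansion x) linear_sumr
  -[RHS](sum_xi_coord (fun j => (left_weight j)%:~R * x 0 j)).
congr (fun_of_matrix _ 0 i); apply: eq_bigr => j _.
by rewrite linearZr_LR /= xi1_mul_xi scalerA mulrC.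
Qed.

Lemma mul_xi1_coord (x : W2 K) (i : 'I_6) :
  W2_mul x (xi K 1) 0 i = (right_weight i)%:~R * x 0 i.
Proof.
rewrite {1}(xi_expansion x) linear_sumlz
  -[RHS](sum_xi_coord (fun j => (right_weight j)%:~R * x 0 j)).
congr (fun_of_matrix _ 0 i); apply: eq_bigr => j _.
by rewrite linearZl_LR /= xi_mul_xi1 scalerA mulrC.
Qed.

Lemma coord_eq0 (m : int) (a : K) : m != 0 -> m%:~R * a = 0 -> a = 0.
Proof.
move=> m_neq0 /eqP.
by rewrite mulf_eq0 intr_eq0_pchar0 // (negbTE m_neq0) => /eqP.
Qed.

(** Comparing [i]-th coordinates in [2 d (e * e) = d e * e + e * d e], where
    [e * e = - e], gives [(l + r + 2) (d e)_i = 0], with [l] and [r] the weights of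
    the [i]-th basis vector; and [l + r + 2] vanishes for [e] only. *)
Lemma half_derivation_xi1 (d : {linear W2 K -> W2 K}) :
  half_derivation (@W2_mul K) d -> d (xi K 1) = d (xi K 1) 0 0 *: xi K 1.
Proof.
move=> /(half_derivationP _ char0 _) hd.
have /= e_idem := hd (xi K 1) (xi K 1).
rewrite [d (xi K 1) in LHS]xi_expansion (bigD1 0) //= big1 ?addr0 // => i i_neq0.
rewrite [d _ 0 i](@coord_eq0 (left_weight i + right_weight i + 2)) ?scale0r //.
  by case: i i_neq0 => [[|[|[|[|[|[|//]]]]]] ?].
have /(congr1 (fun v : 'rV[K]_6 => v 0 i)) := e_idem.
rewrite W2_mul_xi //= linearN scalerN [in RHS]mxE mul_xi1_coord xi1_mul_coord !mxE.
move=> /esym/eqP; rewrite -addr_eq0 => /eqP <-.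
by rewrite !intrD !mulrDl [_ * _ + (right_weight i)%:~R * _]addrC.
Qed.

(** If [D] kills [e] then [2 D (e * v) = e * D v] and [2 D (v * e) = D v * e], so
    [D (xi k)] only has components whose two weights are the doubles of those
    of [xi k]. *)
Lemma weights_double (D : {linear W2 K -> W2 K}) (k i : 'I_6) :
    half_derivation (@W2_mul K) D -> D (xi K 1) = 0 ->
    (left_weight i != 2 * left_weight k) ||
      (right_weight i != 2 * right_weight k) ->
  D (xi K k.+1) 0 i = 0.
Proof.
move=> /(half_derivationP _ char0 _) hD De0.
rewrite -subr_eq0 -[X in _ || ~~ X]subr_eq0.
case/orP=> /coord_eq0; apply; rewrite intrB mulrBl.
  have /(congr1 (fun v : 'rV[K]_6 => v 0 i)) := hD (xi K 1) (xi K k.+1).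
  rewrite De0 linear0l add0r xi1_mul_coord /=.
  rewrite xi1_mul_xi linearZ /= scalerA mxE => <-.
  by rewrite intrM subrr.
have /(congr1 (fun v : 'rV[K]_6 => v 0 i)) := hD (xi K k.+1) (xi K 1).
rewrite De0 linear0r addr0 mul_xi1_coord /= xi_mul_xi1 linearZ /= scalerA mxE => <-.
by rewrite intrM subrr.
Qed.

(** The weights alone leave one degree of freedom, the scalar by which [D] acts
    on [xi 6], the only basis vector whose weights are their own doubles; the
    product [xi 2 * xi 6 = xi 3] removes it. *)
Lemma half_derivation_eq0 (D : {linear W2 K -> W2 K}) :
  half_derivation (@W2_mul K) D -> D (xi K 1) = 0 -> forall x, D x = 0.
Proof.
move=> hD De0.
have D_xi2_5 (k : 'I_6) : (0 < k < 5)%N -> D (xi K k.+1) = 0.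
  move=> k_range; apply/rowP => i; rewrite [RHS]mxE weights_double //.
  case: k k_range => [[|[|[|[|[|[|//]]]]]] ?] // _;
  by case: i => [[|[|[|[|[|[|//]]]]]] ?].
pose c := D (xi K 6) 0 ord_max.
have D_xi6 : D (xi K 6) = c *: xi K 6.
  rewrite [LHS]xi_expansion (bigD1 ord_max) //= big1 ?addr0 // => i i_neq6.
  rewrite (weights_double (k := ord_max)) ?scale0r //.
  by case: i i_neq6 => [[|[|[|[|[|[|//]]]]]] ?].
have D_xi2 : D (xi K 2) = 0 := D_xi2_5 (@Ordinal 6 1 isT) isT.
have D_xi3 : D (xi K 3) = 0 := D_xi2_5 (@Ordinal 6 2 isT) isT.
have c_eq0 : c = 0.
  have := (half_derivationP _ char0 _).1 hD (xi K 2) (xi K 6).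
  rewrite D_xi6 D_xi2 linear0l linearZr_LR /= W2_mul_xi //= D_xi3 scaler0 add0r.
  (* The coordinate along [xi 3] has index 2. *)
  move=> /(congr1 (fun v : 'rV[K]_6 => v 0 (inord 2))).
  by rewrite !mxE !eqxx mulr1.
move=> x; rewrite [x]xi_expansion linear_sum big1 // => k _; rewrite linearZ /=.
have [k_eq0|k_gt0] := posnP k; first by rewrite k_eq0 De0 scaler0.
have [k_lt5|k_ge5] := ltnP k 5; first by rewrite D_xi2_5 ?k_gt0 ?scaler0.
have ->: k = 5%N :> nat by apply/eqP; rewrite eqn_leq k_ge5 -ltnS ltn_ord.
by rewrite D_xi6 c_eq0 scale0r scaler0.
Qed.

End Weights.

Theorem theorem2p1 (K : fieldType) (char0 : [pchar K] =i pred0)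
    (d : {linear W2 K -> W2 K}) :
  half_derivation (@W2_mul K) d <->
  exists lambda : K, forall x : W2 K, d x = lambda *: x.
Proof.
split=> [hd | [lambda dE]]; last exact: (half_derivation_scalar _ char0 dE).
exists (d (xi K 1) 0 0) => x; apply/eqP; rewrite -subr_eq0; apply/eqP.
apply: (half_derivation_eq0 char0 (half_derivation_subZ char0 _ hd)) => /=.
by rewrite -half_derivation_xi1 ?subrr.
Qed.
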